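(* Let $(V,E)$ be a multigraph with no isolated vertex and let $\beta:L^2(E)\to L^2(E)\otimes\mathcal{A}$ be a bi-unitary co-representation of a compact quantum group $(\mathcal{A},\Delta)$. Consider the co-action $Ad_{\overline\beta}$ on $B(L^2(E))$ implemented by the unitary co-representation $\overline\beta$. The following conditions are equivalent: (1) $Ad_{\overline\beta}(T(C(V^t)))\subseteq T(C(V^t))\otimes\mathcal{A}$. (2) There exists a co-action $\alpha_t:C(V^t)\to C(V^t)\otimes\mathcal{A}$ of $(\mathcal{A},\Delta)$ such that $\beta(\chi_\tau)\alpha_t(\chi_j)=\beta(\chi_\tau.\chi_j)$ for all $j\in V^t$ and $\tau\in E$.
   Context: A multigraph $(V,E)$ consists of finite sets $V$ (vertices), $E$ (edges) and source and target maps $s,t:E\to V$. No isolated vertex: every vertex is the source or target of some edge. $E_w=\{\tau\in E:t(\tau)=w\}$ and $V^t=t(E)$. For a finite set $X$, $C(X)$ is the algebra of complex functions on $X$ with basis the characteristic functions $\chi_x$, and $L^2(X)$ is the same space as a Hilbert space with orthonormal basis $(\chi_x)$. $C(V^t)$ acts on the right of $L^2(E)$ by $\chi_\tau.\chi_j=\delta_{t(\tau),j}\chi_\tau$, extended by $(\xi\otimes b)(f\otimes a)=\xi.f\otimes ba$ for $a,b\in\mathcal{A}$. $p_\tau\in B(L^2(E))$ is the projection onto $\mathbb{C}\chi_\tau$, and $T:C(V^t)\to B(L^2(E))$ is the injective algebra map $T(\chi_w)=\sum_{\tau\in E_w}p_\tau$. Compact quantum groups are in Woronowicz's sense; C*-algebras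 are unital, tensor products minimal. A co-representation of $(\mathcal{A},\Delta)$ on $L^2(E)$ is a linear map $\beta$ with $\beta(\chi_\tau)=\sum_\sigma\chi_\sigma\otimes u^\sigma_\tau$ and $\Delta(u^\sigma_\tau)=\sum_\kappa u^\sigma_\kappa\otimes u^\kappa_\tau$; $U=(u^\sigma_\tau)$ is its co-representation matrix. It is unitary if $U$ is unitary; the contragradient $\overline\beta$ has matrix $\overline U=(u^{\sigma*}_\tau)$; $\beta$ is bi-unitary if both $\beta$ and $\overline\beta$ are unitary. $Ad_{\overline\beta}(X)=\overline U(X\otimes1)\overline U^{\,*}$ for $X\in B(L^2(E))$, with $\overline U$ viewed in $B(L^2(E))\otimes\mathcal{A}$. A co-action of $(\mathcal{A},\Delta)$ on a unital C*-algebra $\mathcal{B}$ is a unital $*$-homomorphism $\alpha:\mathcal{B}\to\mathcal{B}\otimes\mathcal{A}$ with $(\alpha\otimes id)\alpha=(id\otimes\Delta)\alpha$ and $\mathrm{span}\,\alpha(\mathcal{B})(1\otimes\mathcal{A})$ norm-dense in $\mathcal{B}\otimes\mathcal{A}$. *)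

(* Defs.v *)
From HB Require Import structures.
From mathcomp Require Import all_boot all_order all_algebra.
From mathcomp Require Import complex reals.

Set Implicit Arguments.
Unset Strict Implicit.
Unset Printing Implicit Defensive.

Import Order.TTheory GRing.Theory Num.Theory.

Local Open Scope ring_scope.

(* Unital complex C*-algebras, with 1 != 0 (inherited from algType). The norm
   cannot be the one of normedModType: the library admits no structure below
   both pzSemiRingType and semiNormedZmodType other than numDomainType. *)
HB.mixin Record isCStarAlgebra (R : realType) A of GRing.Algebra R[i] A := {
  cnorm : A -> R;
  star : A -> A;
  cnorm_eq0 : forall a : A, cnorm a = 0 -> a = 0;
  cnormZ : forall (c : R[i]) (a : A), cnorm (c *: a) = Normc.normc c * cnorm a;
  cnormD : forall a b : A, cnorm (a + b) <= cnorm a + cnorm b;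
  cnormM : forall a b : A, cnorm (a * b) <= cnorm a * cnorm b;
  cnorm_complete : forall u : nat -> A,
    (forall e : R, 0 < e -> exists N : nat, forall m n : nat,
       (N <= m)%N -> (N <= n)%N -> cnorm (u m - u n) < e) ->
    exists l : A, forall e : R, 0 < e -> exists N : nat, forall n : nat,
       (N <= n)%N -> cnorm (u n - l) < e;
  starD : {morph star : a b / a + b};
  starZ : forall (c : R[i]) (a : A), star (c *: a) = c^* *: star a;
  starM : forall a b : A, star (a * b) = star b * star a;
  starK : involutive star;
  cstar_identity : forall a : A, cnorm (star a * a) = cnorm a ^+ 2
}.

#[short(type="cstarType")]
HB.structure Definition CStarAlgebra (R : realType) :=
  {A of GRing.Algebra R[i] A & isCStarAlgebra R A}.

Section CStar.
Variable R : realType.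
Local Notation C := R[i].

Definition star_hom (A B : cstarType R) (f : A -> B) : Prop :=
  [/\ linear f, {morph f : a b / a * b}, f 1 = 1
    & forall a, f (star a) = star (f a)].

Definition lin_indep (A : cstarType R) n (a : 'I_n -> A) : Prop :=
  forall c : 'I_n -> C, \sum_k c k *: a k = 0 -> forall k, c k = 0.

(* [i] and [j] induce a *-homomorphism a (x) b |-> i a * j b on the algebraic
   tensor product of A and B. The last clause says that it is injective. The
   pull-backs of the norm of D along such maps are exactly the C*-norms on the
   algebraic tensor product. *)
Definition faithful_pair (A B D : cstarType R) (i : A -> D) (j : B -> D) :
    Prop :=
  [/\ star_hom i, star_hom j, forall a b, i a * j b = j b * i a
    & forall n (a : 'I_n -> A) (b : 'I_n -> B), lin_indep a ->
        \sum_k i (a k) * j (b k) = 0 -> forall k, b k = 0].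

Definition norm_dense (A : cstarType R) (S : A -> Prop) : Prop :=
  forall (a : A) (e : R), 0 < e -> exists2 b, S b & cnorm (a - b) < e.

(* D is the completion of the algebraic tensor product for its least C*-norm. *)
Definition is_min_tensor (A B D : cstarType R) (i : A -> D) (j : B -> D) :
    Prop :=
  [/\ faithful_pair i j,
      norm_dense (fun x => exists n (a : 'I_n -> A) (b : 'I_n -> B),
                   x = \sum_k i (a k) * j (b k))
    & forall (D' : cstarType R) (i' : A -> D') (j' : B -> D'),
        faithful_pair i' j' ->
        forall n (a : 'I_n -> A) (b : 'I_n -> B),
          cnorm (\sum_k i (a k) * j (b k)) <=
          cnorm (\sum_k i' (a k) * j' (b k)) ].

Record min_tensor (A B : cstarType R) := MinTensor {
  tensor_alg :> cstarType R;
  tensor_inl : A -> tensor_alg;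
  tensor_inr : B -> tensor_alg;
  min_tensorP : is_min_tensor tensor_inl tensor_inr
}.

Definition tens (A B : cstarType R) (M : min_tensor A B) (a : A) (b : B) : M :=
  tensor_inl M a * tensor_inr M b.

(* F = f (x) g; it is determined by this, *-homomorphisms being contractive. *)
Definition is_tensor_map (A B A' B' : cstarType R) (M : min_tensor A B)
    (M' : min_tensor A' B') (f : A -> A') (g : B -> B') (F : M -> M') : Prop :=
  star_hom F /\ forall a b, F (tens M a b) = tens M' (f a) (g b).

Definition is_associator (A B D : cstarType R) (AB : min_tensor A B)
    (BD : min_tensor B D) (L : min_tensor AB D) (M : min_tensor A BD)
    (F : L -> M) : Prop :=
  star_hom F /\ forall a b d, F (tens L (tens AB a b) d) =
                              tens M a (tens BD b d).

(* Minimal tensor products are unique up to isomorphism, so a compact quantum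
   group comes with a model of each one occurring in its axioms. The maps
   Delta (x) id, id (x) Delta and the associativity isomorphism between the
   two models of A (x) A (x) A are uniquely determined. *)
Record cqg := CQG {
  cqg_alg :> cstarType R;
  cqg2 : min_tensor cqg_alg cqg_alg;
  cqg3l : min_tensor cqg2 cqg_alg;
  cqg3r : min_tensor cqg_alg cqg2;
  Delta : cqg_alg -> cqg2;
  Delta_id : cqg2 -> cqg3l;
  id_Delta : cqg2 -> cqg3r;
  cqg_assoc : cqg3l -> cqg3r;
  DeltaP : star_hom Delta;
  Delta_idP : is_tensor_map Delta id Delta_id;
  id_DeltaP : is_tensor_map id Delta id_Delta;
  cqg_assocP : is_associator cqg_assoc;
  Delta_coassoc : forall a, cqg_assoc (Delta_id (Delta a)) = id_Delta (Delta a);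
  Delta_densel : norm_dense (fun x : cqg2 => exists n (a b : 'I_n -> cqg_alg),
                   x = \sum_k Delta (a k) * tens cqg2 (b k) 1);
  Delta_denser : norm_dense (fun x : cqg2 => exists n (a b : 'I_n -> cqg_alg),
                   x = \sum_k Delta (a k) * tens cqg2 1 (b k))
}.

End CStar.

(* For a finite set X and an algebra A, C(X) (x) A is the algebra
   {ffun X -> A} of functions X -> A: the element f (x) a is x |-> f x *: a.
   No completion is needed, and the norm is the sup norm. In particular C(X),
   as well as L^2(X) as a vector space, is {ffun X -> R[i]^o}. *)
Section FiniteSets.
Variables (R : realType) (X : finType).
Local Notation C := R[i].

Definition chi (x : X) : {ffun X -> C^o} := [ffun y => (y == x)%:R].

Definition ftens (A : cstarType R) (f : {ffun X -> C^o}) (a : A) :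
  {ffun X -> A} := [ffun x => f x *: a].

Lemma ftensE (A : cstarType R) (F : {ffun X -> A}) :
  F = \sum_x ftens (chi x) (F x).
Proof.
apply/ffunP => x; rewrite sum_ffunE (bigD1 x) //= big1 => [|y yx].
  by rewrite !ffunE eqxx scale1r addr0.
by rewrite !ffunE eq_sym (negPf yx) scale0r.
Qed.

Variable G : cqg R.

(* alpha (x) id and id (x) Delta, from C(X) (x) A to C(X) (x) (A (x) A) *)
Definition coact_id (alpha : {ffun X -> C^o} -> {ffun X -> G})
    (F : {ffun X -> G}) : {ffun X -> cqg2 G} :=
  [ffun y => \sum_x tens (cqg2 G) (alpha (chi x) y) (F x)].

Definition id_comult (F : {ffun X -> G}) : {ffun X -> cqg2 G} :=
  [ffun y => Delta (F y)].

Record is_coaction (alpha : {ffun X -> C^o} -> {ffun X -> G}) : Prop := {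
  coaction_linear : linear alpha;
  coactionM : {morph alpha : f g / f * g};
  coaction1 : alpha 1 = 1;
  coaction_star : forall f : {ffun X -> C^o},
    alpha [ffun x => (f x : C)^*] = [ffun x => star (alpha f x)];
  coaction_assoc : forall f, coact_id alpha (alpha f) = id_comult (alpha f);
  coaction_dense : forall (F : {ffun X -> G}) (e : R), 0 < e ->
    exists n (f : 'I_n -> {ffun X -> C^o}) (a : 'I_n -> G), forall x,
      cnorm (F x - (\sum_k alpha (f k) * ftens 1 (a k)) x) < e
}.

End FiniteSets.

(* B(L^2(E)) is the algebra of matrices in the orthonormal basis (chi e), with
   E enumerated by enum_rank, and B(L^2(E)) (x) A is the algebra of matrices
   with entries in A. *)
Section Corepresentations.
Variables (R : realType) (E : finType) (G : cqg R).
Local Notation C := R[i].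

Definition optens (A : cstarType R) (X : 'M[C]_#|E|) (a : A) : 'M[A]_#|E| :=
  map_mx (fun c => c *: a) X.

Definition mxstar (A : cstarType R) (M : 'M[A]_#|E|) : 'M[A]_#|E| :=
  (map_mx star M)^T.

Definition mxunitary (A : cstarType R) (M : 'M[A]_#|E|) : Prop :=
  M *m mxstar M = 1%:M /\ mxstar M *m M = 1%:M.

Variable beta : {ffun E -> C^o} -> {ffun E -> G}.

(* u^sigma_tau *)
Definition ucoef (sigma tau : E) : G := beta (chi R tau) sigma.

Definition corep_mx : 'M[G]_#|E| :=
  \matrix_(i, j) ucoef (enum_val i) (enum_val j).

Definition is_corep : Prop :=
  linear beta /\
  forall sigma tau, Delta (ucoef sigma tau) =
    \sum_kappa tens (cqg2 G) (ucoef sigma kappa) (ucoef kappa tau).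

Definition contragradient (x : {ffun E -> C^o}) : {ffun E -> G} :=
  [ffun sigma => \sum_tau x tau *: star (ucoef sigma tau)].

Definition Ad (X : 'M[C]_#|E|) : 'M[G]_#|E| :=
  corep_mx *m optens X (1 : G) *m mxstar corep_mx.

End Corepresentations.

Definition is_biunitary_corep (R : realType) (E : finType) (G : cqg R)
    (beta : {ffun E -> R[i]^o} -> {ffun E -> G}) : Prop :=
  [/\ is_corep beta, mxunitary (corep_mx beta)
    & mxunitary (corep_mx (contragradient beta))].

Lemma corep_mx_contragradient (R : realType) (E : finType) (G : cqg R)
    (beta : {ffun E -> R[i]^o} -> {ffun E -> G}) :
  corep_mx (contragradient beta) = map_mx star (corep_mx beta).
Proof.
apply/matrixP => i j; rewrite !mxE /ucoef ffunE (bigD1 (enum_val j)) //=.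
rewrite big1 => [|k kj]; first by rewrite ffunE eqxx scale1r addr0.
by rewrite ffunE (negPf kj) scale0r.
Qed.

Record multigraph := Multigraph {
  vertex : finType;
  edge : finType;
  msrc : edge -> vertex;
  mtgt : edge -> vertex
}.

Definition no_isolated_vertex (Q : multigraph) : Prop :=
  forall v : vertex Q, exists e : edge Q, msrc e = v \/ mtgt e = v.

Section Multigraph.
Variables (R : realType) (Q : multigraph).
Local Notation C := R[i].
Local Notation E := (edge Q).

(* V^t, as a set and as a finite type *)
Definition Vtset : {set vertex Q} := [set mtgt e | e in [set: E]]%SET.

Definition Vt := {v : vertex Q | v \in Vtset}.

HB.instance Definition _ := SubFinite.on Vt.

Fact mtgt_Vt (e : E) : mtgt e \in Vtset.
Proof. by apply/imsetP; exists e; rewrite ?inE. Qed.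

Definition tgt (e : E) : Vt := exist _ (mtgt e) (mtgt_Vt e).

(* The right action of C(V^t) (x) A on L^2(E) (x) A. With B = R[i] it is the
   right action of C(V^t) on L^2(E); see ract_chi and ract_tens. *)
Definition ract (B : pzRingType) (x : {ffun E -> B}) (f : {ffun Vt -> B}) :
  {ffun E -> B} := [ffun e => x e * f (tgt e)].

Lemma ract_chi (e : E) (j : Vt) :
  ract (chi R e) (chi R j) = (tgt e == j)%:R *: chi R e.
Proof.
apply/ffunP => e'; rewrite !ffunE.
case: eqVneq => [->|_]; first by rewrite mul1r [RHS]mulr1.
by rewrite mul0r scaler0.
Qed.

Lemma ract_tens (A : cstarType R) (x : {ffun E -> C^o}) (f : {ffun Vt -> C^o})
    (b a : A) :
  ract (ftens x b) (ftens f a) = ftens (ract x f) (b * a).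
Proof. by apply/ffunP => e; rewrite !ffunE -scalerAl -scalerAr scalerA. Qed.

Definition pedge (e : E) : 'M[C]_#|E| :=
  delta_mx (enum_rank e) (enum_rank e).

Definition Top (f : {ffun Vt -> C^o}) : 'M[C]_#|E| :=
  \sum_w (f w : C) *: \sum_(e | tgt e == w) pedge e.

(* the subspace T(C(V^t)) (x) A of B(L^2(E)) (x) A *)
Definition in_Top_tensor (A : cstarType R) (M : 'M[A]_#|E|) : Prop :=
  exists n (f : 'I_n -> {ffun Vt -> C^o}) (a : 'I_n -> A),
    M = \sum_k optens (Top (f k)) (a k).

End Multigraph.

(* Main.v *)
Require Import Defs.
From HB Require Import structures.
From mathcomp Require Import all_boot all_order all_algebra.
From mathcomp Require Import complex reals lra.
Import Order.TTheory GRing.Theory Num.Theory.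
Local Open Scope ring_scope.

(** Write u for the matrix of beta and t for the target map. The entry of
    Ad (T chi_w) at edges i, j is the sum of u_ik^* u_jk over the edges k with
    t(k) = w. Invariance of T(C(V^t)) therefore means that this sum vanishes for
    i <> j and, for i = j, depends on t(i) only: it is then q_(t(i), w) for a
    matrix q indexed by vertices ([Ad_Top_block_diagonal]). On the other side,
    with q_vw for the value at v of alpha(chi_w), compatibility of alpha and
    beta says that u_ik q_(t(i), w) is u_ik if t(k) = w and 0 otherwise
    ([compatible_ract]). Multiplying by u or u^* and summing turns either
    relation between u and q into the other, because the contragradient is
    unitary ([block_diagonal_compatible]). So a compatible alpha gives
    invariance at once; for the converse, the matrix q given by invariance has
    to define a co-action.

    Unitarity shows that the entries of q are projections, that those of a row
    are orthogonal with sum 1, and that Delta(q_vw) is the sum over x of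
    q_vx (x) q_xw. Hence alpha is a unital *-homomorphism and is co-associative.
    The real issue is density, for which q must have a right inverse. There
    unitarity of u itself comes in: with n_v the number of edges with target v,
    it yields sum_v n_v q_vw = n_w.

    When projections with weights add up to a scalar, a projection whose weight
    exceeds that scalar vanishes ([proj_le_scalar_eq0]). So q_vw = 0 if
    n_v > n_w, and comparing total weights of the vertices of weight at most l
    gives q_vw = 0 if n_v < n_w as well. Thus q relates only vertices of equal
    weight, and its columns sum to 1. Projections with sum 1 are orthogonal
    ([proj_sum1_orthogonal]), so q times its transpose is the identity
    ([weighted_magic_orthogonal]), and the span that has to be dense is
    everything.

    The positivity used here is derived from the norm axioms of C*-algebras
    without spectral theory. Its core is that a projection is, in hermitian
    directions, an extreme point of the unit ball of its corner
    ([extremal_eq0]), which rests on a discrete form of Liouville's theorem. *)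

(** * Projections in C*-algebras *)

Section CStarAlgebra.
Context {R : realType} {A : cstarType R}.
Implicit Types (a b e p x : A) (z t : R[i]).

Lemma star0 : star (0 : A) = 0.
Proof. by apply: (addrI (star (0 : A))); rewrite -starD !addr0. Qed.

Lemma starN a : star (- a) = - star a.
Proof. by apply/eqP; rewrite -addr_eq0 -starD addNr star0. Qed.

Lemma starB a b : star (a - b) = star a - star b.
Proof. by rewrite starD starN. Qed.

Lemma star1 : star (1 : A) = 1.
Proof. by rewrite -[RHS]starK -[star 1 in RHS]mulr1 starM starK mulr1. Qed.

Lemma star_sum (I : Type) (r : seq I) (P : pred I) (F : I -> A) :
  star (\sum_(i <- r | P i) F i) = \sum_(i <- r | P i) star (F i).
Proof. exact: (big_morph _ starD star0). Qed.

Lemma cnorm0 : cnorm (0 : A) = 0.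
Proof. by rewrite -(scale0r 0) cnormZ Normc.normc0 mul0r. Qed.

Lemma cnormN a : cnorm (- a) = cnorm a.
Proof. by rewrite -scaleN1r cnormZ normcN Normc.normc1 mul1r. Qed.

Lemma cnorm_ge0 a : 0 <= cnorm a.
Proof.
have := cnormD a (- a); rewrite subrr cnorm0 cnormN -mulr2n.
by rewrite pmulrn_lge0.
Qed.

Lemma cnorm_sum (I : Type) (r : seq I) (P : pred I) (F : I -> A) :
  cnorm (\sum_(i <- r | P i) F i) <= \sum_(i <- r | P i) cnorm (F i).
Proof.
elim/big_rec2: _ => [|i y x _ le_xy]; first by rewrite cnorm0.
exact: le_trans (cnormD _ _) (lerD (lexx _) le_xy).
Qed.

Lemma cnormMn a n : cnorm (a *+ n) = cnorm a *+ n.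
Proof. by rewrite -scaler_nat cnormZ normcMn Normc.normc1 mulr_natl. Qed.

Definition proj p : Prop := star p = p /\ p * p = p.

Lemma proj_compl {p} : proj p -> proj (1 - p).
Proof.
case=> ps pp; split; first by rewrite starB star1 ps.
by rewrite mulrBr mulr1 mulrBl mul1r pp subrr subr0.
Qed.

Lemma cnorm_projE {p} : proj p -> cnorm p = (p != 0)%:R.
Proof.
case=> ps pp; have := cstar_identity p; rewrite ps pp => e2.
have [->|p0] := eqVneq p 0; first exact: cnorm0.
have n0 : cnorm p != 0 by apply: contra_neq p0; apply: cnorm_eq0.
by rewrite (mulfI n0 (etrans (mulr1 _) e2)).
Qed.

Lemma cnorm_proj {p} : proj p -> cnorm p <= 1.
Proof. by move/cnorm_projE ->; case: (p != 0); rewrite ?lexx ?ler01. Qed.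

Lemma cnormM_le1 a b : cnorm a <= 1 -> cnorm b <= 1 -> cnorm (a * b) <= 1.
Proof.
move=> a1 b1; apply: le_trans (cnormM _ _) _.
by apply: mulr_ile1; rewrite ?cnorm_ge0.
Qed.

Lemma cnorm_corner_compl {p q : A} :
  proj p -> proj q -> cnorm (p - p * q * p) <= 1.
Proof.
move=> hp hq; have -> : p - p * q * p = p * (1 - q) * p.
  by rewrite mulrBr mulrBl mulr1 hp.2.
by rewrite !cnormM_le1 ?cnorm_proj //; apply: proj_compl.
Qed.

(** Compress the sum to the corner of [p k]. Each [p k - p k * p i * p k] lies
    in the unit ball, so their sum over [i != k] has norm at most the remaining
    weight [M]; but that sum is [M + n k - N] times [p k], and [M + n k - N]
    exceeds [M]. *)
Lemma proj_le_scalar_eq0 (I : finType) (p : I -> A) (n : I -> nat) N k :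
  (forall i, proj (p i)) -> \sum_i p i *+ n i = 1 *+ N -> (N < n k)%N ->
  p k = 0.
Proof.
move=> hp sumE ltNk; set P := p k.
set M := (\sum_(i | i != k) n i)%N.
have PP : P * P = P by case: (hp k).
have E : \sum_(i | i != k) (P - P * p i * P) *+ n i = P *+ (M + n k - N).
  rewrite (eq_bigr (fun i => P *+ n i - P * (p i *+ n i) * P)); last first.
    by move=> i _; rewrite mulrnBl mulrnAr mulrnAl.
  rewrite sumrB -mulr_suml -mulr_sumr sumrMnr -/M.
  move: sumE; rewrite (bigD1 k) //= -/P => /(canRL (addKr _)) ->.
  rewrite mulrDr mulrDl mulrN mulNr !(mulrnAr, mulrnAl) mulr1 !PP.
  rewrite mulrnBr ?mulrnDr; last by rewrite (leq_trans (ltnW ltNk)) ?leq_addl.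
  by rewrite opprD opprK addrA.
have: cnorm (P *+ (M + n k - N)) <= M%:R.
  rewrite -E; apply: le_trans (cnorm_sum _ _ _ _) _.
  rewrite /M natr_sum; apply: ler_sum => i _; rewrite cnormMn.
  apply: ler_wMn2r; exact: cnorm_corner_compl (hp k) (hp i).
rewrite cnormMn (cnorm_projE (hp k)) -addnBA 1?ltnW //.
case: eqP => // _; rewrite ler_nat -[X in (_ <= X)%N]addn0 leq_add2l.
by rewrite leqn0 subn_eq0 leqNgt ltNk.
Qed.

Lemma normc_ge0 z : 0 <= Normc.normc z.
Proof. by case: z => x y; apply: sqrtr_ge0. Qed.

Lemma normc_real (r : R) : 0 <= r -> Normc.normc r%:C%C = r.
Proof. by move=> r0; rewrite /= expr0n addr0 sqrtr_sqr ger0_norm. Qed.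

Lemma ReIm_le_normc z :
  `|complex.Re z| <= Normc.normc z /\ `|complex.Im z| <= Normc.normc z.
Proof.
case: z => x y /=; rewrite -!sqrtr_sqr.
by split; rewrite ler_wsqrtr // ?lerDl ?lerDr sqr_ge0.
Qed.

(** Liouville's theorem in a form without limits: if no [t - a] contracts below
    [|t|], then, splitting [g] into linear factors, [g(a)] does not contract
    below [|g(0)|]. The bound is only
    required on the corner that has [e] as left unit. *)
Lemma cnorm_horner_ge e a (g : {poly R[i]}) x :
  (forall t x, e * x = x ->
     Normc.normc t * cnorm x <= cnorm (t *: x - a * x)) ->
  e * a = a -> e * x = x ->
  Normc.normc g.[0] * cnorm x <= cnorm (horner_alg a g * x).
Proof.
move=> lower ea; have [r ->] := closed_field_poly_normal g.
move=> ex; rewrite hornerZ Normc.normcM -mul_polyC rmorphM /= horner_algC.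
rewrite mulr_algl -scalerAl cnormZ -mulrA.
apply: ler_wpM2l; first exact: normc_ge0.
elim: r x ex => [|t r IHr] x ex.
  by rewrite !big_nil hornerC Normc.normc1 rmorph1 !mul1r.
rewrite !big_cons hornerM Normc.normcM hornerXsubC sub0r normcN.
(* [a - t] is applied first: it keeps [e * x = x], as the induction needs. *)
rewrite (mulrC ('X - _)) rmorphM rmorphB /= horner_algX horner_algC.
set y := t *: x - a * x; rewrite -!mulrA.
have -> : (a - t%:A) * x = - y by rewrite mulrBl mulr_algl opprB.
rewrite mulrN cnormN mulrCA.
have ey : e * y = y by rewrite mulrBr -scalerAr mulrA ea ex.
apply: le_trans (IHr y ey); rewrite ler_wpM2l ?lower //.
exact: normc_ge0.
Qed.

(** Averaging the squares of [e + a] and [e - a] bounds [e + a * a], hence by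
    the C*-identity [e + 'i a] and [e - 'i a]; convexity then bounds [e + z a]
    for all [z] in the square spanned by 1, 'i, -1 and -'i. It follows that
    [t - a] does not contract below [|t|], so that [cnorm_horner_ge] applies to
    g = ((1 + X)^n - 1) / X, with g(0) = n. As a g(a) = (e + a)^n - e has norm
    at most 2, the norm of [a] is at most 2 / n for every n. *)
Lemma extremal_eq0 e a : proj e -> star a = a -> e * a = a -> a * e = a ->
  cnorm (e + a) <= 1 -> cnorm (e - a) <= 1 -> a = 0.
Proof.
move=> he sa ea ae plus minus; have [se ee] := he.
have sqr : cnorm (e + a * a) <= 1.
  have -> : e + a * a = 2^-1 *: ((e + a) * (e + a) + (e - a) * (e - a)).
    rewrite mulrBl !mulrBr !mulrDl !mulrDr ee ea ae opprB addrACA.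
    rewrite (addrACA e a e) subrr addr0 (addrC _ (- a)) (addrACA a _ (- a)).
    rewrite subrr add0r -!mulr2n -mulrnDl -(scaler_nat 2 (e + a * a)).
    by rewrite scalerK // pnatr_eq0.
  have -> : 2^-1 = (2^-1)%:C%C :> R[i].
    by rewrite rmorphV ?unitfE ?pnatr_eq0 // rmorph_nat.
  rewrite cnormZ normc_real ?invr_ge0 // mulrC ler_pdivrMr // mul1r.
  apply: le_trans (cnormD _ _) _.
  by rewrite -[2]/(1 + 1) lerD ?cnormM_le1.
have imag (s : R[i]) : s = 'i%C \/ s = - 'i%C -> cnorm (e + s *: a) <= 1.
  move=> hs.
  have : cnorm (e + s *: a) ^+ 2 <= 1.
    rewrite -cstar_identity starD starZ se sa.
    rewrite mulrDl !mulrDr ee -!scalerAl -!scalerAr ea ae scalerA.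
    have -> : s^* = - s by case: hs => ->; simpc.
    have -> : - s * s = 1 by case: hs => ->; simpc.
    by rewrite scale1r scaleNr addrA addrK.
  by rewrite expr_le1 ?cnorm_ge0.
have disc (z : R[i]) : `|complex.Re z| + `|complex.Im z| <= 1 ->
    cnorm (e + z *: a) <= 1.
  case: z => x y /= xy.
  have [s1 n1 z1] : exists2 s : R[i],
      cnorm (e + s *: a) <= 1 & `|x|%:C%C * s = x%:C%C.
    case: (ger0P x) => _; [exists 1 | exists (-1)];
      rewrite ?scaleN1r ?scale1r ?mulr1 //.
    by rewrite mulrN1 rmorphN opprK.
  have [s2 n2 z2] : exists2 s : R[i],
      cnorm (e + s *: a) <= 1 & `|y|%:C%C * s = y%:C%C * 'i%C.
    case: (ger0P y) => _; [exists 'i%C | exists (-'i%C)]; rewrite ?imag //;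
      try by [left | right].
    by rewrite mulrN rmorphN mulNr opprK.
  have -> : e + (x +i* y)%C *: a = (1 - `|x| - `|y|)%:C%C *: e +
      `|x|%:C%C *: (e + s1 *: a) + `|y|%:C%C *: (e + s2 *: a).
    rewrite [(x +i* y)%C]complexE [complex.Re _]/= [complex.Im _]/=.
    rewrite (mulrC 'i%C) -z1 -z2 scalerDl !rmorphB rmorph1.
    rewrite !scalerDr !scalerBl !scalerA.
    by rewrite scale1r [_ - _ + (_ + _)]addrA (addrAC e) subrK addrACA subrK.
  rewrite (le_trans (cnormD _ _)) // (le_trans (lerD (cnormD _ _) (lexx _))) //.
  rewrite !cnormZ !normc_real ?subr_ge0 // ?lerBrDr //;
    last by rewrite -lerBrDr; lra.
  apply: (@le_trans _ _ ((1 - `|x| - `|y|) * 1 + `|x| * 1 + `|y| * 1));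
    last by lra.
  by apply: lerD; [apply: lerD|]; apply: ler_wpM2l => //;
    rewrite ?cnorm_proj // -addrA -opprD subr_ge0.
have lower t x : e * x = x -> Normc.normc t * cnorm x <= cnorm (t *: x - a * x).
  move=> ex; have [->|t0] := eqVneq t 0.
    by rewrite Normc.normc0 mul0r cnorm_ge0.
  set r := Normc.normc t.
  have r0 : 0 < r.
    rewrite lt0r normc_ge0 andbT; apply: contra_neq t0.
    exact: Normc.eq0_normc.
  have [w nw tE] : exists2 w, Normc.normc w = 1 & t = r%:C%C * w.
    have rC0 : r%:C%C != 0 :> R[i].
      by rewrite (fmorph_eq0 (real_complex R)) gt_eqF.
    exists (r%:C%C^-1 * t); last by rewrite mulVKf.
    by rewrite Normc.normcM Normc.normcV normc_real ?ltW // mulVf ?gt_eqF.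
  have n2 : Normc.normc (2 : R[i]) = 2 by rewrite normcMn Normc.normc1.
  have w0 : 2 * w != 0.
    rewrite mulf_neq0 ?pnatr_eq0 //; apply/eqP => w0.
    by move: nw; rewrite w0 Normc.normc0 => /esym/eqP; rewrite oner_eq0.
  (* The factor 2 brings the inverse of [2 * w] into the square of [disc]. *)
  have nz : cnorm (e + (2 * w)^-1 *: a) <= 1.
    apply: disc; set z := _^-1.
    have : Normc.normc z = 2^-1.
      by rewrite Normc.normcV Normc.normcM nw n2 mulr1.
    have [] := ReIm_le_normc z; lra.
  (* The left side has norm [(r + 2) |x|], the last summand at most [2 |x|]. *)
  have E : ((r + 2)%:C%C * w) *: x =
      (t *: x - a * x) + (2 * w) *: ((e + (2 * w)^-1 *: a) * x).
    rewrite [(e + _) * x]mulrDl -scalerAl ex scalerDr scalerA divff // scale1r.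
    by rewrite [RHS]addrACA addNr addr0 -scalerDl tE rmorphD rmorph_nat mulrDl.
  have := cnormD (t *: x - a * x) ((2 * w) *: ((e + (2 * w)^-1 *: a) * x)).
  rewrite -E !cnormZ !Normc.normcM nw n2 !mulr1 normc_real; last by lra.
  have := cnormM (e + (2 * w)^-1 *: a) x.
  have := ler_wpM2r (cnorm_ge0 x) nz; lra.
apply: cnorm_eq0; apply/eqP; rewrite eq_le cnorm_ge0 andbT leNgt.
apply/negP => a0.
pose n := Num.bound (2 / cnorm a).
have ltn : 2 / cnorm a < n%:R by rewrite archi_boundP // divr_ge0 ?cnorm_ge0.
pose g : {poly R[i]} := \sum_(i < n) (1 + 'X) ^+ i.
have g0 : Normc.normc g.[0] = n%:R.
  rewrite horner_sum (eq_bigr (fun=> 1)); last first.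
    by move=> i _; rewrite horner_exp !hornerE expr1n.
  by rewrite sumr_const card_ord normcMn Normc.normc1.
have gaE : horner_alg a g * a = (1 + a) ^+ n * e - e.
  have : g * 'X = (1 + 'X) ^+ n - 1 by rewrite subrX1 addrAC subrr add0r mulrC.
  move/(congr1 (horner_alg a)).
  rewrite rmorphM rmorphB rmorphXn rmorphD !rmorph1 /= horner_algX.
  by move/(congr1 ( *%R^~ e)); rewrite -mulrA ae mulrBl mul1r.
have bound m : cnorm ((1 + a) ^+ m * e) <= 1.
  elim: m => [|m IHm]; first by rewrite expr0 mul1r cnorm_proj.
  rewrite exprSr -mulrA mulrDl mul1r ae.
  have -> : e + a = e * (e + a) by rewrite mulrDr ee ea.
  by rewrite mulrA cnormM_le1.
have := cnorm_horner_ge e a g a lower ea ea; rewrite g0 gaE.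
move/le_trans/(_ (cnormD _ _)); rewrite cnormN leNgt => /negP; apply.
apply: le_lt_trans (lerD (bound n) (cnorm_proj he)) _.
by rewrite -ltr_pdivrMr.
Qed.

(** In the corner of [e = p k] the compressions [y j] with [j != k] sum to 0, so
    that [- y i] is the sum of the other ones. Each [e - y j] has norm at most
    1; this bounds [(M + 1) e + y i] and [(M + 1) e - y i] by [M + 1], where
    [M] counts the other indices. By extremality of [e], [y i] vanishes, and it
    is the square of the modulus of [p i * p k]. *)
Lemma proj_sum1_orthogonal (I : finType) (p : I -> A) i k :
  (forall j, proj (p j)) -> \sum_j p j = 1 -> i != k -> p i * p k = 0.
Proof.
move=> hp sum1 ik; set e := p k; have he : proj e := hp k.
have [se ee] := he; pose y j := e * p j * e.
pose M := #|[pred j | (j != k) && (j != i)]|.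
have sumM : e *+ M + y i = \sum_(j | (j != k) && (j != i)) (e - y j).
  rewrite sumrB sumr_const -/M; congr (_ + _); apply/eqP.
  rewrite -addr_eq0 -(bigD1 i (P := predC1 k)) //=.
  apply/eqP; apply: (addrI (y k)).
  rewrite -(bigD1 k (P := predT)) //= addr0 /y -mulr_suml -mulr_sumr sum1.
  by rewrite mulr1 !ee.
have normM : cnorm (e *+ M + y i) <= M%:R.
  rewrite sumM; apply: le_trans (cnorm_sum _ _ _ _) _.
  apply: le_trans (ler_sum _ (fun j _ => cnorm_corner_compl he (hp j))) _.
  by rewrite sumr_const.
(* [M.+1] rather than [M], which is 0 when [i] and [k] are all the indices. *)
have Mgt0 : 0 < M.+1%:R :> R by rewrite ltr0n.
have normV : Normc.normc (M.+1%:R^-1 : R[i]) = M.+1%:R^-1.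
  by rewrite Normc.normcV normcMn Normc.normc1.
have scaleM x : e + M.+1%:R^-1 *: x = M.+1%:R^-1 *: (e *+ M.+1 + x).
  by rewrite scalerDr -(scaler_nat M.+1 e) scalerK // pnatr_eq0.
have a0 : (M.+1%:R^-1 : R[i]) *: y i = 0.
  apply: (extremal_eq0 e) => //.
  - rewrite starZ rmorphV ?unitfE ?pnatr_eq0 // rmorph_nat /y !starM se.
    by rewrite (hp i).1 mulrA.
  - by rewrite -scalerAr /y !mulrA ee.
  - by rewrite -scalerAl /y -!mulrA ee.
  - rewrite scaleM cnormZ normV mulrC ler_pdivrMr // mul1r mulrS -addrA.
    apply: le_trans (cnormD _ _) _; rewrite [M.+1%:R]mulrS.
    by rewrite lerD // cnorm_proj.
  - rewrite -scalerN scaleM cnormZ normV mulrC ler_pdivrMr // mul1r mulrSr.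
    rewrite -addrA.
    apply: le_trans (cnormD _ _) _; rewrite [M.+1%:R]mulrSr.
    rewrite lerD ?cnorm_corner_compl // cnormMn.
    exact: ler_wMn2r (cnorm_proj he).
have y0 : y i = 0.
  apply: (scalerI _ (etrans a0 (esym (scaler0 _ _)))).
  by rewrite invr_eq0 pnatr_eq0.
apply: cnorm_eq0; apply/eqP; rewrite -sqrf_eq0 -cstar_identity.
by rewrite starM se (hp i).1 mulrA -(mulrA e) (hp i).2 -/(y i) y0 cnorm0.
Qed.

(** The matrix [q] is stochastic with projection entries and leaves the weight
    [n] invariant; it is shown to be block diagonal along the level sets of [n],
    with magic unitary blocks. *)
Lemma weighted_magic_orthogonal (V : finType) (n : V -> nat) (q : V -> V -> A) :
  (forall v, (0 < n v)%N) -> (forall v w, proj (q v w)) ->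
  (forall v, \sum_w q v w = 1) ->
  (forall w, \sum_v q v w *+ n v = 1 *+ n w) ->
  forall v v', \sum_w q v w * q v' w = (v == v')%:R.
Proof.
move=> n_gt0 hq row col.
have gt_eq0 v w : (n w < n v)%N -> q v w = 0.
  exact: (proj_le_scalar_eq0 _ (fun v => q v w) n (n w) v).
have lt_eq0 v w : (n v < n w)%N -> q v w = 0.
  (* Sum the columns of weight at most [l]: by [gt_eq0] only rows of weight at
     most [l] contribute, and these have the same total weight, so that [S], the
     contribution that they lack, is 0. *)
  move=> ltvw; pose l := n v.
  pose S : A := \sum_(i | (n i <= l)%N) \sum_(j | (l < n j)%N) q i j *+ n i.
  have S0 : S = 0.
    have : \sum_(j | (n j <= l)%N) \sum_i q i j *+ n i =
        \sum_(j | (n j <= l)%N) 1 *+ n j by apply: eq_bigr.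
    rewrite exchange_big /= (bigID (fun i => (n i <= l)%N)) /=.
    rewrite [X in _ + X]big1 ?addr0; last first.
      move=> i; rewrite -ltnNge => ltlx; apply: big1 => j leyl.
      by rewrite gt_eq0 ?mul0rn // (leq_ltn_trans leyl).
    move=> eqS; apply: (addrI (\sum_(i | (n i <= l)%N)
                                 \sum_(j | (n j <= l)%N) q i j *+ n i)).
    rewrite addr0 [RHS]eqS /S -big_split /=; apply: eq_bigr => i _.
    rewrite -(row i) -sumrMnl [RHS](bigID (fun j => (n j <= l)%N)) /=.
    by congr (_ + _); apply: eq_bigl => j; rewrite ltnNge.
  have := proj_le_scalar_eq0 _ (fun z : V * V => q z.1 z.2)
    (fun z : V * V => (((n z.1 <= l) && (l < n z.2)) * n z.1)%N) 0 (v, w).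
  apply => //=; last by rewrite leqnn ltvw mul1n.
  rewrite mulr0n -[RHS]S0 /S pair_big_dep [RHS]big_mkcond /=.
  by apply: eq_bigr => z _; case: ifP => _; rewrite ?mul1n ?mul0n ?mulr0n.
have col1 w : \sum_v q v w = 1.
  have := col w.
  rewrite (eq_bigr (fun v => q v w *+ n w)); last first.
    by move=> v _; have [/gt_eq0->|/lt_eq0->|-> //] := ltngtP (n w) (n v);
      rewrite !mul0rn.
  rewrite sumrMnl => /eqP.
  rewrite -(scaler_nat _ (\sum_i _)) -(scaler_nat _ (1 : A)).
  rewrite -subr_eq0 -scalerBr scaler_eq0.
  by rewrite pnatr_eq0 -leqn0 leqNgt n_gt0 /= subr_eq0 => /eqP.
move=> v v'; have [<-|vv'] := eqVneq v v'.
  by under eq_bigr => w _ do rewrite (hq v w).2; rewrite row.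
rewrite big1 // => w _; apply: (proj_sum1_orthogonal _ (fun v => q v w)) => //.
Qed.
End CStarAlgebra.

(** * Linear maps and minimal tensor products *)

Section LinearMaps.
Context {K : pzRingType} {U W : lmodType K} {f : U -> W}.
Hypothesis lin : linear f.

Lemma linear_prop0 : f 0 = 0.
Proof. by have := lin (-1) 0 0; rewrite scaler0 addr0 scaleN1r addNr. Qed.

Lemma linear_propZ c x : f (c *: x) = c *: f x.
Proof. by rewrite -[c *: x]addr0 lin linear_prop0 addr0. Qed.

Lemma linear_prop_sum (I : Type) (r : seq I) (P : pred I) (F : I -> U) :
  f (\sum_(i <- r | P i) F i) = \sum_(i <- r | P i) f (F i).
Proof.
apply: (big_morph f _ linear_prop0) => x y.
by rewrite -[x]scale1r lin !scale1r.
Qed.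
End LinearMaps.

Section Tensors.
Context {R : realType} {A B : cstarType R} {M : min_tensor A B}.

Lemma tensM (a a' : A) (b b' : B) :
  tens M (a * a') (b * b') = tens M a b * tens M a' b'.
Proof.
rewrite /tens; have [[[_ iM _ _] [_ jM _ _] comm _] _ _] := min_tensorP M.
by rewrite iM jM -!mulrA; congr (_ * _); rewrite !mulrA comm.
Qed.

Lemma star_tens (a : A) (b : B) : star (tens M a b) = tens M (star a) (star b).
Proof.
rewrite /tens; have [[[_ _ _ istar] [_ _ _ jstar] comm _] _ _] := min_tensorP M.
by rewrite starM -istar -jstar comm.
Qed.

Lemma tens_linearr (a : A) : linear (tens M a).
Proof.
have [[_ [jlin _ _ _] _ _] _ _] := min_tensorP M.
by move=> c b b'; rewrite /tens jlin mulrDr scalerAr.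
Qed.

Lemma tens_suml (I : Type) (r : seq I) (P : pred I) (F : I -> A) (b : B) :
  tens M (\sum_(i <- r | P i) F i) b = \sum_(i <- r | P i) tens M (F i) b.
Proof.
have [[[ilin _ _ _] _ _ _] _ _] := min_tensorP M.
by rewrite /tens (linear_prop_sum ilin) mulr_suml.
Qed.
End Tensors.

(** * Block-diagonal conjugates and their coefficients *)

Section BlockDiagonal.
Context {R : realType} {A : cstarType R} {E V : finType}.
Variables (t : E -> V) (u : E -> E -> A) (q : V -> V -> A).
Hypothesis ubar_isometry :
  forall i j, \sum_k u k i * star (u k j) = (i == j)%:R.
Hypothesis ubar_coisometry :
  forall i j, \sum_k star (u i k) * u j k = (i == j)%:R.

Definition block_diagonal : Prop := forall i j w,
  \sum_(k | t k == w) star (u i k) * u j k = if i == j then q (t i) w else 0.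

Definition right_compatible : Prop := forall i k w,
  u i k * q (t i) w = if t k == w then u i k else 0.

(** From left to right, multiply the relation for [j] by [u j k] and sum over
    [j]; from right to left, multiply by [star (u i k)] and sum over [k]. Either
    sum collapses by unitarity of the conjugate matrix. *)
Lemma block_diagonal_compatible : block_diagonal <-> right_compatible.
Proof.
split=> H.
- move=> i k w.
  transitivity (\sum_j u j k * \sum_(l | t l == w) star (u j l) * u i l).
    rewrite (bigD1 i) //= H eqxx big1 ?addr0 // => j ji.
    by rewrite H (negPf ji) mulr0.
  under eq_bigr => j _ do rewrite mulr_sumr.
  rewrite exchange_big /=.
  under eq_bigr => l _ do
    (under eq_bigr => j _ do rewrite mulrA; rewrite -mulr_suml ubar_isometry).
  rewrite big_mkcond (bigD1 k) //= eqxx mul1r big1 ?addr0 // => l.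
  by rewrite eq_sym => lk; rewrite (negPf lk) mul0r if_same.
- move=> i j w; rewrite big_mkcond.
  transitivity (\sum_k star (u i k) * u j k * q (t j) w).
    by apply: eq_bigr => k _; rewrite -mulrA H; case: ifP; rewrite ?mulr0.
  rewrite -mulr_suml ubar_coisometry.
  by case: eqVneq => [->|_]; rewrite ?mul1r ?mul0r.
Qed.

Hypothesis t_surj : forall v, exists i, t i = v.
Hypothesis qP : block_diagonal.

Lemma block_star v w : star (q v w) = q v w.
Proof.
have [i <-] := t_surj v; have := qP i i w; rewrite eqxx => <-.
by rewrite star_sum; apply: eq_bigr => k _; rewrite starM starK.
Qed.

(** By compatibility, right multiplication by [q v w'] selects from the sum
    defining [q v w] the terms whose index lies over [w']. *)
Lemma block_rowM v w w' : q v w * q v w' = if w == w' then q v w else 0.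
Proof.
have [i <-] := t_surj v; have := qP i i w; rewrite eqxx => <-.
rewrite mulr_suml; under eq_bigr => k /eqP tk.
  rewrite -mulrA (block_diagonal_compatible.1 qP) tk; over.
by case: ifP => _ //; rewrite big1 // => k _; rewrite mulr0.
Qed.

Lemma block_proj v w : proj (q v w).
Proof. by split; [apply: block_star | rewrite block_rowM eqxx]. Qed.

Lemma block_row_sum v : \sum_w q v w = 1.
Proof.
have [i <-] := t_surj v.
have := ubar_coisometry i i.
rewrite eqxx /= mulr1n (partition_big t predT) //= => <-.
by apply: eq_bigr => w _; rewrite qP eqxx.
Qed.

Hypothesis u_isometry :
  forall i j, \sum_k star (u k i) * u k j = (i == j)%:R.

Let fibre v := #|[pred k | t k == v]|.

(** Weighting [v] by its fibre turns the sum over [V] into one over [E], where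
    the columns of [u] have norm 1. *)
Lemma block_col_sum w : \sum_v q v w *+ fibre v = 1 *+ fibre w.
Proof.
transitivity (\sum_i q (t i) w).
  rewrite [RHS](partition_big t predT) //=; apply: eq_bigr => v _.
  by rewrite -sumr_const; apply: eq_big => [i|i /eqP->].
transitivity (\sum_i \sum_(k | t k == w) star (u i k) * u i k).
  by apply: eq_bigr => i _; rewrite qP eqxx.
rewrite exchange_big -sumr_const; apply: eq_bigr => k _.
by rewrite u_isometry eqxx.
Qed.

Lemma block_orthogonal v v' : \sum_w q v w * q v' w = (v == v')%:R.
Proof.
apply: (weighted_magic_orthogonal _ fibre).
- by move=> x; have [i ti] := t_surj x; apply/card_gt0P; exists i; apply/eqP.
- exact: block_proj.
- exact: block_row_sum.
- exact: block_col_sum.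
Qed.
End BlockDiagonal.

(** * Matrix entries indexed by edges *)

Section MatrixEntries.
Context {E : finType}.

Lemma mx_rankP (S : Type) (M N : 'M[S]_#|E|) :
  (forall i j, M (enum_rank i) (enum_rank j) = N (enum_rank i) (enum_rank j)) ->
  M = N.
Proof.
by move=> MN; apply/matrixP => i j; rewrite -(enum_valK i) -(enum_valK j).
Qed.

Lemma mulmx_rank (S : pzSemiRingType) (M N : 'M[S]_#|E|) i j :
  (M *m N) (enum_rank i) (enum_rank j) =
  \sum_k M (enum_rank i) (enum_rank k) * N (enum_rank k) (enum_rank j).
Proof.
by rewrite mxE (reindex _ (onW_bij _ (enum_rank_bij E))).
Qed.

Lemma mxstarE (R : realType) (A : cstarType R) (M : 'M[A]_#|E|) i j :
  mxstar M i j = star (M j i).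
Proof. by rewrite 2!mxE. Qed.

Lemma optensE (R : realType) (A : cstarType R) (X : 'M[R[i]]_#|E|) (a : A) i j :
  optens X a i j = X i j *: a.
Proof. exact: mxE. Qed.
End MatrixEntries.

Section Biunitary.
Context {R : realType} {E : finType} {G : cqg R}.
Context {beta : {ffun E -> R[i]^o} -> {ffun E -> G}}.
Hypothesis beta_bi : is_biunitary_corep beta.
Local Notation u := (ucoef beta).

Lemma corep_mx_rank i j : corep_mx beta (enum_rank i) (enum_rank j) = u i j.
Proof. by rewrite mxE !enum_rankK. Qed.

Lemma contra_mx_rank i j :
  corep_mx (contragradient beta) (enum_rank i) (enum_rank j) = star (u i j).
Proof. by rewrite corep_mx_contragradient mxE corep_mx_rank. Qed.

Lemma scalar1_rank i j :
  (1%:M : 'M[G]_#|E|) (enum_rank i) (enum_rank j) = (i == j)%:R.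
Proof. by rewrite mxE (inj_eq enum_rank_inj). Qed.

Lemma corep_isometry i j : \sum_k star (u k i) * u k j = (i == j)%:R.
Proof.
have [_ [_ /matrixP UU] _] := beta_bi.
rewrite -scalar1_rank -UU mulmx_rank; apply: eq_bigr => k _.
by rewrite mxstarE !corep_mx_rank.
Qed.

Lemma contra_isometry i j : \sum_k u k i * star (u k j) = (i == j)%:R.
Proof.
have [_ _ [_ /matrixP UU]] := beta_bi.
rewrite -scalar1_rank -UU mulmx_rank; apply: eq_bigr => k _.
by rewrite mxstarE !contra_mx_rank starK.
Qed.

Lemma contra_coisometry i j : \sum_k star (u i k) * u j k = (i == j)%:R.
Proof.
have [_ _ [/matrixP UU _]] := beta_bi.
rewrite -scalar1_rank -UU mulmx_rank; apply: eq_bigr => k _.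
by rewrite mxstarE !contra_mx_rank starK.
Qed.
End Biunitary.

(** * The co-action on the target vertices *)

Section Targets.
Context {R : realType} {Q : multigraph}.
Local Notation E := (edge Q).
Implicit Type f : {ffun Vt Q -> R[i]^o}.

Lemma tgt_surj (v : Vt Q) : exists e, tgt e = v.
Proof.
case: v => v vV; have /imsetP[e _ ve] := vV.
by exists e; apply: val_inj.
Qed.

Lemma Top_rank f (i j : E) :
  Top f (enum_rank i) (enum_rank j) = if i == j then f (tgt i) : R[i] else 0.
Proof.
rewrite summxE (bigD1 (tgt i)) //= mxE summxE (bigD1 i) //= mxE eqxx.
rewrite [X in _ + X]big1 => [|w wi]; last first.
  rewrite mxE summxE big1 ?mulr0 // => e /eqP te.
  rewrite mxE !(inj_eq enum_rank_inj); case: eqVneq => //= ie.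
  by move: wi; rewrite -te ie eqxx.
rewrite big1 => [|e /andP[_ ei]]; last first.
  by rewrite mxE !(inj_eq enum_rank_inj) eq_sym (negPf ei).
rewrite !addr0 (inj_eq enum_rank_inj) eq_sym.
by case: eqP; rewrite ?mulr1 ?mulr0.
Qed.

Lemma in_Top_tensorP (A : cstarType R) (M : 'M[A]_#|E|) :
  in_Top_tensor M <-> exists g : Vt Q -> A, forall i j,
    M (enum_rank i) (enum_rank j) = if i == j then g (tgt i) else 0.
Proof.
split=> [[n [f [a ->]]]|[g Mg]].
  exists (fun v => \sum_k f k v *: a k) => i j; rewrite summxE.
  case: eqVneq => [<-|ij]; last rewrite big1 //; [apply: eq_bigr|]; move=> k _;
    by rewrite optensE Top_rank ?eqxx // (negPf ij) scale0r.
exists #|{: Vt Q}|, (fun k => chi R (enum_val k)), (fun k => g (enum_val k)).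
apply: mx_rankP => i j; rewrite Mg summxE.
rewrite -(big_enum_val (fun v =>
  optens (Top (chi R v)) (g v) (enum_rank i) (enum_rank j))).
rewrite (bigD1 (tgt i)) //= big1 ?addr0 => [|v vi].
  rewrite optensE Top_rank.
  by case: eqP => _; rewrite ?scale0r // ffunE eqxx scale1r.
rewrite optensE Top_rank ffunE (eq_sym (tgt i)) (negPf vi).
by case: eqP => _; rewrite scale0r.
Qed.

Lemma Ad_Top_rank (G : cqg R) (beta : {ffun E -> R[i]^o} -> {ffun E -> G})
    f (i j : E) :
  Ad (contragradient beta) (Top f) (enum_rank i) (enum_rank j) =
  \sum_k f (tgt k) *: (star (ucoef beta i k) * ucoef beta j k).
Proof.
rewrite mulmx_rank; apply: eq_bigr => k _.
rewrite mxstarE contra_mx_rank starK mulmx_rank (bigD1 k) //= big1 => [|l lk].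
  rewrite contra_mx_rank optensE Top_rank eqxx addr0.
  by rewrite -scalerAr mulr1 -scalerAl.
by rewrite optensE Top_rank (negPf lk) scale0r mulr0.
Qed.

Context {G : cqg R} {beta : {ffun E -> R[i]^o} -> {ffun E -> G}}.
Hypothesis beta_bi : is_biunitary_corep beta.
Local Notation u := (ucoef beta).

Lemma Ad_Top_block_diagonal :
  (forall f, in_Top_tensor (Ad (contragradient beta) (Top f))) <->
  exists q : Vt Q -> Vt Q -> G, block_diagonal (@tgt Q) u q.
Proof.
split=> [H | [q qP] f].
  pose P w (g : {ffun Vt Q -> G}) := forall i j,
    \sum_(k | tgt k == w) star (u i k) * u j k =
    if i == j then g (tgt i) else 0.
  have /fin_all_exists[g gP] w : exists g, P w g.
    have /in_Top_tensorP[g gP] := H (chi R w); exists [ffun v => g v] => i j.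
    rewrite ffunE -gP Ad_Top_rank big_mkcond; apply: eq_bigr => k _.
    by rewrite ffunE; case: eqP; rewrite ?scale1r ?scale0r.
  by exists (fun v w => g w v) => i j w; apply: gP.
apply/in_Top_tensorP; exists (fun v => \sum_w f w *: q v w) => i j.
rewrite Ad_Top_rank (partition_big (@tgt Q) predT) //=.
transitivity (\sum_w f w *: (if i == j then q (tgt i) w else 0)).
  apply: eq_bigr => w _; rewrite -qP scaler_sumr.
  by apply: eq_bigr => k /eqP->.
by case: eqP => // _; rewrite big1 // => w _; rewrite scaler0.
Qed.

Lemma compatible_ract (alpha : {ffun Vt Q -> R[i]^o} -> {ffun Vt Q -> G}) :
  (forall e j, ract (beta (chi R e)) (alpha (chi R j)) =
               beta (ract (chi R e) (chi R j))) <->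
  right_compatible (@tgt Q) u (fun v w => alpha (chi R w) v).
Proof.
have [[lin _] _ _] := beta_bi.
have E1 e j i :
    beta (ract (chi R e) (chi R j)) i = if tgt e == j then u i e else 0.
  rewrite ract_chi (linear_propZ lin) ffunE.
  by case: eqP; rewrite ?scale1r ?scale0r.
split=> H.
  by move=> i k w; rewrite -E1 -H ffunE.
by move=> e j; apply/ffunP => i; rewrite E1 -H ffunE.
Qed.

Section Coaction.
Variable q : Vt Q -> Vt Q -> G.
Hypothesis qP : block_diagonal (@tgt Q) u q.

(** In Delta(u_ik^* u_ik), summing over the [k] above [w] first makes the right
    tensor factor block diagonal, hence zero off the diagonal and
    constant on fibres; summing the left factors over a fibre gives [q v x]. *)
Lemma Delta_block v w :
  Delta (q v w) = \sum_x tens (cqg2 G) (q v x) (q x w).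
Proof.
have [lin DM _ Dstar] := DeltaP G.
have [[_ Du] _ _] := beta_bi.
have [i iv] := tgt_surj v; have := qP i i w; rewrite eqxx iv => <-.
rewrite (linear_prop_sum lin).
transitivity (\sum_(k | tgt k == w) \sum_l \sum_m
    tens (cqg2 G) (star (u i l) * u i m) (star (u l k) * u m k)).
  apply: eq_bigr => k _; rewrite DM Dstar !Du star_sum mulr_suml.
  apply: eq_bigr => l _; rewrite mulr_sumr; apply: eq_bigr => m _.
  by rewrite star_tens -tensM.
rewrite exchange_big (partition_big (@tgt Q) predT) //=.
apply: eq_bigr => x _; have := qP i i x; rewrite eqxx iv => <-.
rewrite tens_suml; apply: eq_bigr => l /eqP lx.
rewrite exchange_big /= (bigD1 l) //= [X in _ + X]big1 => [|m ml].
  by rewrite addr0 -(linear_prop_sum (tens_linearr _)) qP eqxx lx.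
rewrite -(linear_prop_sum (tens_linearr _)) qP eq_sym (negPf ml).
exact: linear_prop0 (tens_linearr _).
Qed.

Definition block_coaction f : {ffun Vt Q -> G} :=
  [ffun v => \sum_w (f w : R[i]) *: q v w].

Lemma block_coaction_chi v w : block_coaction (chi R w) v = q v w.
Proof.
rewrite ffunE (bigD1 w) //= big1 => [|x xw].
  by rewrite ffunE eqxx scale1r addr0.
by rewrite ffunE (negPf xw) scale0r.
Qed.

(** The span in the density condition contains every [F]: as [q] times its
    transpose is the identity, F is the sum over w of alpha(chi_w) (1 (x) a_w)
    with a_w = sum_x q_xw F(x). *)
Lemma block_coactionP : is_coaction block_coaction.
Proof.
have isoC := contra_isometry beta_bi; have coisoC := contra_coisometry beta_bi.
have orth :=
  block_orthogonal _ _ _ isoC coisoC tgt_surj qP (corep_isometry beta_bi).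
have rowM := block_rowM _ _ _ isoC coisoC tgt_surj qP.
split.
- move=> c f g; apply/ffunP => v; rewrite !ffunE scaler_sumr -big_split /=.
  by apply: eq_bigr => w _; rewrite !ffunE scalerDl scalerA.
- move=> f g; apply/ffunP => v; rewrite !ffunE mulr_suml.
  apply: eq_bigr => w _; rewrite mulr_sumr (bigD1 w) //= big1 => [|x xw].
    by rewrite addr0 -scalerAl -scalerAr scalerA rowM eqxx ffunE.
  by rewrite -scalerAl -scalerAr rowM eq_sym (negPf xw) !scaler0.
- apply/ffunP => v; rewrite !ffunE.
  rewrite -[RHS](block_row_sum _ _ _ coisoC tgt_surj qP v).
  by apply: eq_bigr => w _; rewrite ffunE scale1r.
- move=> f; apply/ffunP => v; rewrite !ffunE star_sum; apply: eq_bigr => w _.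
  by rewrite starZ (block_star _ _ _ tgt_surj qP) ffunE.
- move=> f; apply/ffunP => v; rewrite !ffunE.
  have [lin _ _ _] := DeltaP G; rewrite (linear_prop_sum lin).
  under [RHS]eq_bigr => w _ do
    rewrite (linear_propZ lin) Delta_block scaler_sumr.
  rewrite exchange_big; apply: eq_bigr => x _.
  rewrite block_coaction_chi ffunE (linear_prop_sum (tens_linearr _)).
  by apply: eq_bigr => w _; rewrite (linear_propZ (tens_linearr _)).
- move=> F eps eps0.
  pose a w := \sum_x q x w * F x.
  have inverse v : \sum_w (block_coaction (chi R w) * ftens 1 (a w)) v = F v.
    transitivity (\sum_w \sum_x q v w * q x w * F x).
      apply: eq_bigr => w _; rewrite ffunE block_coaction_chi !ffunE scale1r.
      by rewrite mulr_sumr; apply: eq_bigr => x _; rewrite mulrA.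
    rewrite exchange_big (bigD1 v) //= [X in _ + X]big1 => [|x xv].
      by rewrite -mulr_suml orth eqxx mul1r addr0.
    by rewrite -mulr_suml orth eq_sym (negPf xv) mul0r.
  exists #|{: Vt Q}|, (fun k => chi R (enum_val k)),
    (fun k => a (enum_val k)) => v.
  rewrite sum_ffunE -(big_enum_val (fun w =>
    (block_coaction (chi R w) * ftens 1 (a w)) v)).
  by rewrite inverse subrr cnorm0.
Qed.
End Coaction.
End Targets.

Theorem theorem3p5 (R : realType) (Q : multigraph) (G : cqg R)
    (beta : {ffun edge Q -> R[i]^o} -> {ffun edge Q -> G}) :
  no_isolated_vertex Q ->
  is_biunitary_corep beta ->
  (forall f : {ffun Vt Q -> R[i]^o},
     in_Top_tensor (Ad (contragradient beta) (Top f)))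
  <->
  (exists2 alpha : {ffun Vt Q -> R[i]^o} -> {ffun Vt Q -> G},
     is_coaction alpha &
     forall (e : edge Q) (j : Vt Q),
       ract (beta (chi R e)) (alpha (chi R j)) =
       beta (ract (chi R e) (chi R j))).
Proof.
move=> _ beta_bi; rewrite Ad_Top_block_diagonal.
have compat q := block_diagonal_compatible (@tgt Q) (ucoef beta) q
  (contra_isometry beta_bi) (contra_coisometry beta_bi).
split.
  case=> q qP.
  exists (block_coaction q); first exact: (block_coactionP beta_bi q qP).
  apply/(compatible_ract beta_bi) => i k w.
  by rewrite block_coaction_chi; apply: (compat q).1.
case=> alpha _ /(compatible_ract beta_bi) H.
by exists (fun v w => alpha (chi R w) v); apply/compat.
Qed.
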